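(* Let $\tau>0$, $k>0$ and $m>0$. Assume the distributions of a positive random variable $f$ under the null and alternative hypotheses are described by $$H_0:\ f\sim F(k,m,0),\qquad\qquad H_1:\ f\mid\lambda\sim F(k,m,\lambda),\quad \lambda\mid\tau^2\sim G\left(\frac{k}{2}+1,\frac{1}{2\tau^2}\right).$$ Then, for every $f>0$, the Bayes factor in favor of the alternative hypothesis is $$BF_{10}(f\mid\tau^2)=(\tau^2+1)^{-\frac{k}{2}-1}\left[\frac{1+\frac{kf}{m}}{1+\frac{kf}{v}}\right]^{\frac{k+m}{2}}\left[1+\frac{(k+m)\tau^2f}{v\left(1+\frac{kf}{v}\right)}\right],$$ where $v=m(\tau^2+1)$.
   Context: $F(k,m,\lambda)$ denotes the (non-central) $F$ distribution with $k$ and $m$ (numerator and denominator) degrees of freedom and non-centrality parameter $\lambda\ge0$, with density on $f>0$ $$\left(\frac{k}{m}\right)^{k/2}e^{-\lambda/2}\sum_{r=0}^\infty\left(\frac{k\lambda}{2m}\right)^r\frac{1}{r!}\,B\left(\frac{k}{2}+r,\frac{m}{2}\right)^{-1}\frac{f^{\,r+k/2-1}}{(1+kf/m)^{r+(k+m)/2}},$$ where $B(a,b)=\Gamma(a)\Gamma(b)/\Gamma(a+b)$ is the beta function (with $0^0=1$, so $F(k,m,0)$ is the central $F$ distribution). $G(\alpha,\beta)$ denotes the gamma distribution with shape parameter $\alpha$ and rate parameter $\beta$, with density $\frac{\beta^\alpha}{\Gamma(\alpha)}x^{\alpha-1}e^{-\beta x}$ on $x>0$. The hyperparameter $\tau^2$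 is a fixed constant. The Bayes factor in favor of the alternative hypothesis based on a test statistic $x$ is $BF_{10}(x\mid\tau^2)=m_1(x\mid\tau^2)/m_0(x)$, where $m_0(x)$ is the density of the statistic under $H_0$, and $m_1(x\mid\tau^2)=\int p(x\mid\lambda)\,\pi(\lambda\mid\tau^2)\,d\lambda$ is its marginal density under $H_1$. Here $p(x\mid\lambda)$ is the density of the statistic given $\lambda$ under $H_1$ and $\pi(\lambda\mid\tau^2)$ is the prior density of $\lambda$ under $H_1$. *)

(* Defs.v *)
From HB Require Import structures.
From mathcomp Require Import all_boot all_order all_algebra.
From mathcomp Require Import all_classical all_reals all_analysis.

Set Implicit Arguments.
Unset Strict Implicit.
Unset Printing Implicit Defensive.

Import Order.TTheory GRing.Theory Num.Theory.
Import numFieldNormedType.Exports.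

Local Open Scope classical_set_scope.
Local Open Scope ring_scope.

(* Meaningful for [0 < a], where the integral is finite. *)
Definition Gamma (R : realType) (a : R) : R :=
  Rintegral lebesgue_measure `]0, +oo[ (fun t => t `^ (a - 1) * expR (- t)).

(* The library's [beta_fun] only has [nat] parameters. *)
Definition Beta (R : realType) (a b : R) : R :=
  Gamma a * Gamma b / Gamma (a + b).

Definition gamma_pdf (R : realType) (shape rate : R) (x : R) : R :=
  if 0 < x then
    rate `^ shape / Gamma shape * x `^ (shape - 1) * expR (- (rate * x))
  else 0.

Definition ncF_term (R : realType) (k m lambda f : R) (r : nat) : R :=
  (k * lambda / (2 * m)) ^+ r / r`!%:R / Beta (k / 2 + r%:R) (m / 2)
  * (f `^ (r%:R + k / 2 - 1) / (1 + k * f / m) `^ (r%:R + (k + m) / 2)).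

(* Valued in the extended reals so that, for [0 <= lambda], the series of
   nonnegative terms has a value without any convergence argument. *)
Definition ncF_pdf (R : realType) (k m lambda : R) (f : R) : \bar R :=
  if 0 < f then
    (((k / m) `^ (k / 2) * expR (- lambda / 2))%:E
       * \sum_(0 <= r <oo) (ncF_term k m lambda f r)%:E)%E
  else 0%E.

(* [Theta] is the parameter space; [p x lambda] is the density of the
   statistic at [x] given [lambda], and [prior] the prior density. *)
Definition marginal (R : realType) (Theta : set R) (p : R -> R -> \bar R)
    (prior : R -> R) (x : R) : \bar R :=
  (\int[lebesgue_measure]_(lambda in Theta) (p x lambda * (prior lambda)%:E))%E.

Definition bayes_factor (R : realType) (m0 m1 : R -> \bar R) (x : R) : \bar R :=
  (m1 x / m0 x)%E.

(* Bayes factor of [H1 : f | lambda ~ F(k, m, lambda)],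
   [lambda | tau2 ~ G(k / 2 + 1, 1 / (2 * tau2))],
   against [H0 : f ~ F(k, m, 0)]. *)
Definition BF10 (R : realType) (k m tau2 : R) : R -> \bar R :=
  bayes_factor
    (ncF_pdf k m 0)
    (marginal `[0, +oo[
       (fun f lambda => ncF_pdf k m lambda f)
       (gamma_pdf (k / 2 + 1) (1 / (2 * tau2)))).

(* Main.v *)
Require Import Defs.
From mathcomp Require Import all_boot all_order all_algebra.
From mathcomp Require Import all_classical all_reals all_analysis.
From mathcomp Require Import measurable_realfun ring lra.
Import Order.TTheory GRing.Theory Num.Theory.
Import numFieldNormedType.Exports.
Local Open Scope classical_set_scope.
Local Open Scope ring_scope.

(** Write a = k/2, c = (k+m)/2, t = tau^2. By Tonelli the marginal density is
    a series of gamma integrals over lambda, and the powers of lambda only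
    shift the shape parameter. After division by the central density, the r-th
    term is
      (1+t)^(-a-1) (Gamma(c+r) / (Gamma(c) r!)) z^r (1 + r/a),
      z = k f t / ((m + k f) (1 + t)),
    where the factor 1 + r/a comes from Gamma(a+r+1) = (a+r) Gamma(a+r).
    The negative binomial series sums it to
      (1+t)^(-a-1) (1-z)^(-c) (1 + (c/a) z/(1-z)). *)

(** * Scaling of Lebesgue measure and of integrals over the positive half-line *)

(** By uniqueness of Lebesgue measure it suffices to compare on intervals []a, b]]. Their preimage
    is []a / c, b / c]], whose length the factor [c] restores. *)
Lemma lebesgue_measure_scale {R : realType} (c : R) (A : set R) : 0 < c ->
  measurable A ->
  (c%:E * pushforward lebesgue_measure
    ( *%R c : _ -> measurableTypeR R) A)%E = lebesgue_measure A.
Proof.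
move=> c0 mA.
have mc : measurable_fun [set: measurableTypeR R] ( *%R c : _ -> measurableTypeR R).
  exact: measurable_funM.
transitivity (mscale (NngNum (ltW c0))
  (measure_function_pushforward__canonical__measure_function_Measure
     lebesgue_measure mc) A) => //.
apply/esym/lebesgue_measure_unique => {A mA}//.
move=> _ [[a b]] _ <-.
change (lebesgue_measure `]a, b]%classic =
  c%:E * lebesgue_measure ( *%R c @^-1` `]a, b]%classic))%E.
rewrite (_ : _ @^-1` _ = `](a / c), (b / c)]%classic); last first.
  apply/seteqP; split => x /=; rewrite !in_itv/= ltr_pdivrMr// ler_pdivlMr//;
    by rewrite [x * c]mulrC.
rewrite !lebesgue_measure_itv/= !lte_fin ltr_pM2r ?invr_gt0//.
case: ifPn => _; last by rewrite mule0.
by rewrite -!EFinB -EFinM; congr EFin; field; rewrite gt_eqF.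
Qed.

(** The positive half-line is its own preimage under multiplication by [c], so this is the change of
    variables for a pushforward combined with the scaling of the measure. *)
Lemma ge0_integral_scale {R : realType} (c : R) (f : R -> \bar R) : 0 < c ->
  measurable_fun (`]0, +oo[ : set R) f -> (forall x, 0 < x -> (0 <= f x)%E) ->
  (\int[@lebesgue_measure R]_(x in `]0%R, +oo[) f x =
   c%:E * \int[@lebesgue_measure R]_(x in `]0%R, +oo[) f (c * x)%R)%E.
Proof.
move=> c0 mf f0.
have mc : measurable_fun [set: measurableTypeR R] ( *%R c : _ -> measurableTypeR R).
  exact: measurable_funM.
rewrite [in RHS](_ : `]0, +oo[%classic =
    ( *%R c : _ -> measurableTypeR R) @^-1` `]0, +oo[); last first.
  by apply/seteqP; split => x /=; rewrite !in_itv/= !andbT pmulr_rgt0.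
rewrite -(ge0_integral_pushforward mc)//=; last first.
  by move=> x; rewrite inE/= in_itv/= andbT; exact: f0.
rewrite -(@ge0_integral_mscale _ _ _ _ _ _ (NngNum (ltW c0)))//=; last first.
  by move=> x /=; rewrite in_itv/= andbT; exact: f0.
by apply: eq_measure_integral => A mA _; exact/esym/lebesgue_measure_scale.
Qed.

(** * Improper integration by parts and the boundary behaviour of its primitives *)

(** On compact subintervals the integrals of [f] and [g] differ by an increment of [F], which tends
    to 0 as the intervals exhaust the half-line. Splitting [F'] into two nonnegative parts gives an
    equality in the extended reals, with no finiteness assumed. *)
Lemma integral_eq_deriv_sub {R : realType} (F f g : R -> R) :
  (forall x : R, 0 < x -> 0 <= f x) -> (forall x : R, 0 < x -> 0 <= g x) ->
  (forall x : R, 0 < x -> {for x, continuous f}) ->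
  (forall x : R, 0 < x -> {for x, continuous g}) ->
  (forall x : R, 0 < x -> is_derive x 1 F (f x - g x)) ->
  F x @[x --> 0^'+] --> 0 -> F x @[x --> +oo] --> 0 ->
  (\int[@lebesgue_measure R]_(x in `]0%R, +oo[) (f x)%:E =
   \int[@lebesgue_measure R]_(x in `]0%R, +oo[) (g x)%:E)%E.
Proof.
move=> f0 g0 cf cg dF F0 Fy.
(* The shift by 2 gives [a n < 1 < b n] already at [n = 0], so no interval of the exhaustion
   degenerates. *)
pose a n : R := n.+2%:R^-1; pose b n : R := n.+2%:R.
have a0 n : 0 < a n by rewrite invr_gt0 ltr0n.
have ab n : a n < b n.
  by rewrite (@lt_trans _ _ 1)// ?invf_lt1 ?ltr0n// ltr1n.
have cvg_b : b n @[n --> \oo] --> +oo.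
  exact: (cvg_comp _ _ (cvg_addnl 2) (@cvgr_idn R)).
have aba n x : `[a n, b n]%classic x -> 0 < x.
  by rewrite /= in_itv/= => /andP[+ _]; exact: lt_le_trans.
have ndab : {homo (fun n => `[a n, b n]%classic) : n m / (n <= m)%N >-> (n <= m)%O}.
  move=> n p np; apply/subsetPset => x /=; rewrite !in_itv/= => /andP[ax xb].
  rewrite (le_trans _ ax)/= ?(le_trans xb) ?ler_nat ?ltnS//.
  by rewrite lef_pV2 ?posrE ?ltr0n// ler_nat !ltnS.
have Uab : \bigcup_n `[a n, b n]%classic = `]0, +oo[%classic :> set R.
  apply/seteqP; split => x /=.
    by move=> [n _] /aba; rewrite in_itv/= andbT.
  rewrite in_itv/= andbT => x0.
  near \oo => n; exists n => //=; rewrite in_itv/=; apply/andP; split; last first.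
    by near: n; move/cvgryPge : cvg_b; exact.
  rewrite -[leRHS]invrK lef_pV2 ?posrE ?invr_gt0//.
  by near: n; move/cvgryPge : cvg_b; exact.
have within_ab (h : R -> R) n : (forall x : R, 0 < x -> {for x, continuous h}) ->
    {within `[a n, b n], continuous h}.
  move=> ch; apply: continuous_in_subspaceT => x; rewrite inE => /aba.
  exact: ch.
have cvgI (h : R -> R) : (forall x : R, 0 < x -> 0 <= h x) ->
    (forall x : R, 0 < x -> {for x, continuous h}) ->
    (\int[@lebesgue_measure R]_(x in `[a n, b n]) (h x)%:E @[n --> \oo] -->
     \int[@lebesgue_measure R]_(x in `]0%R, +oo[) (h x)%:E)%E.
  move=> h0 ch; rewrite -Uab; apply: ge0_nondecreasing_set_cvg_integral => //.
    move=> n; apply/measurable_EFinP; apply: subspace_continuous_measurable_fun => //.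
    exact: within_ab.
  by move=> n x /aba x0; rewrite lee_fin h0.
have intI (h : R -> R) n : (forall x : R, 0 < x -> {for x, continuous h}) ->
    (@lebesgue_measure R).-integrable `[a n, b n] (EFin \o h).
  move=> ch; apply: continuous_compact_integrable; first exact: segment_compact.
  exact: within_ab.
have cF x : 0 < x -> {for x, continuous F}.
  by move=> x0; have [d _] := dF _ x0; apply/differentiable_continuous/derivable1_diffP.
have fg n : (\int[@lebesgue_measure R]_(x in `[a n, b n]) (f x)%:E =
    (F (b n) - F (a n))%:E + \int[@lebesgue_measure R]_(x in `[a n, b n]) (g x)%:E)%E.
  rewrite EFinB -(@continuous_FTC2 _ (fun x => f x - g x)%R)//.
  - under [X in (X + _)%E]eq_integral do rewrite EFinB.
    rewrite integralB_EFin//; [|exact: intI..].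
    rewrite subeK//; apply: integrable_fin_num => //; exact: intI.
  - apply: within_ab => x x0; apply: continuousB; [exact: cf|exact: cg].
  - split.
    + move=> x; rewrite in_itv/= => /andP[ax _].
      by have [] := dF x (lt_trans (a0 n) ax).
    + by apply: cvg_at_right_filter; apply: cF.
    + by apply: cvg_at_left_filter; apply: cF; rewrite ltr0n.
  - move=> x; rewrite in_itv/= => /andP[ax _]; rewrite derive1E.
    by have [] := dF x (lt_trans (a0 n) ax).
(* The truncated integrals of [f] also converge to the full integral of [f]; uniqueness of limits
   concludes. *)
suff cvgfg : (\int[@lebesgue_measure R]_(x in `[a n, b n]) (f x)%:E @[n --> \oo] -->
     \int[@lebesgue_measure R]_(x in `]0%R, +oo[) (g x)%:E)%E.
  exact: (cvg_unique _ (cvgI f f0 cf) cvgfg).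
under eq_fun do rewrite fg.
rewrite -[(\int[@lebesgue_measure R]_(x in `]0%R, +oo[) (g x)%:E)%E]add0e.
apply: cvgeD; [by []| |exact: cvgI].
apply: cvg_EFin; first by near=> n.
rewrite /= -(subr0 (0:R)); apply: cvgB.
  apply: (cvg_comp b F) Fy.
  exact: cvg_b.
move/cvg_at_rightP : F0; apply; split => //.
rewrite /a; apply/(gtr0_cvgV0 (f := b)) => //; apply: nearW => n; rewrite ltr0n.
Unshelve. all: by end_near.
Qed.

(** For [x >= 1] and an integer [n > |a|], the bound [x ^ (n+1) / (n+1)! <= exp x] squeezes the
    product between 0 and [(n+1)! / x]. *)
Lemma cvg_powR_expRN {R : realType} (a : R) :
  x `^ a * expR (- x) @[x --> +oo] --> 0.
Proof.
pose n := Num.bound `|a|.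
apply: (@squeeze_cvgr _ _ _ _ (cst 0) (fun x => n.+1`!%:R * x^-1)).
- near=> x.
  have x1 : 1 <= x by near: x; exact: nbhs_pinfty_ge.
  have x0 : 0 < x by exact: lt_le_trans x1.
  rewrite mulr_ge0 ?powR_ge0 ?expR_ge0//= expRN ler_pdivrMr ?expR_gt0//.
  rewrite (@le_trans _ _ (x ^+ n))//.
    rewrite -powR_mulrn ?(ltW x0)// ler_powR// (le_trans (ler_norm a))//.
    exact/ltW/archi_boundP.
  rewrite mulrAC ler_pdivlMr// -exprSr mulrC -ler_pdivrMr ?ltr0n ?fact_gt0//.
  by apply: le_trans (expR_ge1Dxn n (ltW x0)); rewrite lerDr.
- exact: cvg_cst.
- rewrite -(mulr0 n.+1`!%:R); apply: cvgM; first exact: cvg_cst.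
  by apply/gtr0_cvgV0 => //; exact: nbhs_pinfty_gt.
Unshelve. all: by end_near. Qed.

Lemma continuous_powR {R : realType} (a x : R) : 0 < x ->
  {for x, continuous (@powR R ^~ a)}.
Proof.
move=> x0; have [d _] := is_derive1_powR a x0.
exact/differentiable_continuous/derivable1_diffP.
Qed.

Lemma continuous_powR_expRN {R : realType} (a x : R) : 0 < x ->
  {for x, continuous (fun t : R => t `^ a * expR (- t))}.
Proof.
move=> x0; apply: continuousM; first exact: continuous_powR.
apply: continuous_comp; first exact: continuousN.
exact: continuous_expR.
Qed.

(** * The Gamma function: recursion, finiteness, positivity, and change of rate *)

(** The extended-real integral of which [Gamma] is the finite part. Its recursion can be established
    before finiteness, and then serves to prove finiteness. *)
Definition gamma_integral {R : realType} (a : R) : \bar R :=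
  (\int[@lebesgue_measure R]_(t in `]0%R, +oo[) (t `^ (a - 1) * expR (- t))%:E)%E.

Lemma measurable_powR_expR {R : realType} (D : set R) (a : R) (g : R -> R) :
  measurable_fun D g -> measurable_fun D (fun t => t `^ a * expR (g t)).
Proof.
move=> mg; apply: measurable_funM; first exact: measurable_funTS (measurable_powR _).
exact: measurableT_comp.
Qed.

Lemma measurable_powR_expRN {R : realType} (D : set R) (a : R) :
  measurable_fun D (fun t => (t `^ a * expR (- t))%:E).
Proof.
apply/measurable_EFinP; apply: measurable_powR_expR.
exact: oppr_measurable.
Qed.

Lemma gamma_integral_ge0 {R : realType} (a : R) : (0 <= gamma_integral a)%E.
Proof.
by apply: integral_ge0 => t _; rewrite lee_fin mulr_ge0 ?powR_ge0 ?expR_ge0.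
Qed.

(** Integration by parts: the derivative of [t ^ a * exp (- t)] is the difference of the two
    integrands, and this primitive vanishes at both ends. *)
Lemma gamma_integralS {R : realType} (a : R) : 0 < a ->
  gamma_integral (a + 1) = (a%:E * gamma_integral a)%E.
Proof.
move=> a0; rewrite /gamma_integral addrK -ge0_integralZl_EFin//; last 3 first.
- by move=> x _; rewrite lee_fin mulr_ge0 ?powR_ge0 ?expR_ge0.
- exact: measurable_powR_expRN.
- exact: ltW.
under [RHS]eq_integral do rewrite -EFinM.
apply/esym/(@integral_eq_deriv_sub _ (fun t => t `^ a * expR (- t))).
- by move=> x _; rewrite !mulr_ge0 ?(ltW a0) ?powR_ge0 ?expR_ge0.
- by move=> x _; rewrite !mulr_ge0 ?powR_ge0 ?expR_ge0.
- move=> x x0; apply: continuousM; first exact: cvg_cst.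
  exact: continuous_powR_expRN.
- by move=> x x0; exact: continuous_powR_expRN.
- move=> x x0; have := is_derive1_powR a x0 => ?.
  apply: is_derive_eq.
  by rewrite /GRing.scale/=; ring.
- rewrite -[X in _ --> X](mul0r (expR (- (0:R)))).
  apply: cvgM; first exact: powR_cvg0.
  apply: cvg_at_right_filter; apply: continuous_comp; first exact: continuousN.
  exact: continuous_expR.
- exact: cvg_powR_expRN.
Qed.

Lemma gamma_integral1 {R : realType} : gamma_integral (1 : R) = 1%E.
Proof.
rewrite /gamma_integral integral_itv_obnd_cbnd; last exact: measurable_powR_expRN.
under eq_integral do rewrite subrr powRr0 mul1r.
have cE : continuous (fun x : R => expR (- x)).
  by move=> x; apply: continuous_comp; [exact: continuousN|exact: continuous_expR].
rewrite (@ge0_continuous_FTC2y _ _ (fun x => - expR (- x)) _ 0)//.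
- by rewrite oppr0 expR0 EFinN oppeK add0e.
- exact: continuous_subspaceT.
- by rewrite -oppr0; apply: cvgN; exact: cvgr_expR.
- by apply: cvg_at_right_filter; apply: cvgN; exact: cE.
- by move=> x _; rewrite derive1E derive_val; rewrite /GRing.scale/=; ring.
Qed.

(** Positive integers follow by recursion from 1, real arguments at least 1 by domination, and the
    remaining ones by using the recursion backwards. *)
Lemma gamma_integral_lty {R : realType} (a : R) : 0 < a -> (gamma_integral a < +oo)%E.
Proof.
have gamma_integral_nat n : (gamma_integral (n.+1%:R : R) < +oo)%E.
  elim: n => [|n IH]; first by rewrite gamma_integral1 ltry.
  by rewrite -(natr1 n.+1) gamma_integralS ?ltr0n// lte_mul_pinfty// ?lee_fin ?ltr0n.
have gamma_integral_ge1 (b : R) : 1 <= b -> (gamma_integral b < +oo)%E.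
  move=> b1; pose n := Num.bound b.
  (* Pointwise [t ^ (b - 1) <= 1 + t ^ n]: the first summand dominates for [t <= 1], the second for
     [t > 1] since [n > b]. *)
  suff le_gamma : (gamma_integral b <=
      gamma_integral (1 : R) + gamma_integral (n.+1%:R : R))%E.
    apply: (le_lt_trans le_gamma).
    by rewrite gamma_integral1 lte_add_pinfty// ltry.
  rewrite /gamma_integral -ge0_integralD//; last 4 first.
  - by move=> x _; rewrite lee_fin mulr_ge0 ?powR_ge0 ?expR_ge0.
  - exact: measurable_powR_expRN.
  - by move=> x _; rewrite lee_fin mulr_ge0 ?powR_ge0 ?expR_ge0.
  - exact: measurable_powR_expRN.
  apply: ge0_le_integral => //=.
  - by move=> x _; rewrite lee_fin mulr_ge0 ?powR_ge0 ?expR_ge0.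
  - exact: measurable_powR_expRN.
  - by apply: emeasurable_funD; exact: measurable_powR_expRN.
  - move=> x; rewrite in_itv/= andbT => x0.
    rewrite -EFinD lee_fin -mulrDl ler_wpM2r ?expR_ge0// subrr powRr0.
    have [x1|x1] := leP x 1.
      rewrite (@le_trans _ _ 1)// ?lerDl ?powR_ge0//.
      by rewrite -[leRHS](powRr0 x); apply: ger_powR; rewrite ?x0 ?x1 ?subr_ge0.
    rewrite (@le_trans _ _ (x `^ (n.+1%:R - 1)))// ?lerDr ?ler01//.
    rewrite ler_powR ?(ltW x1)// lerB// (le_trans (ltW (archi_boundP _)))//.
      exact: le_trans b1.
    by rewrite ler_nat.
(* As [a + 1 >= 1], the product of [a] with the integral at [a] is finite; an infinite integral
   would contradict [a > 0]. *)
move=> a0; have := gamma_integral_ge1 (a + 1).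
rewrite lerDr (ltW a0) gamma_integralS// => /(_ isT).
have := gamma_integral_ge0 a; case: (gamma_integral a) => [r _ _|_|//]; first exact: ltry.
by rewrite gt0_muley ?lte_fin.
Qed.

(** A zero integral would force the integrand to vanish almost everywhere, but it is positive on the
    whole half-line, which has infinite measure. *)
Lemma gamma_integral_gt0 {R : realType} (a : R) : (0 < gamma_integral a)%E.
Proof.
rewrite lt0e gamma_integral_ge0 andbT; apply/eqP => g0.
have mf : measurable_fun (`]0, +oo[ : set R)
    (fun t => (t `^ (a - 1) * expR (- t))%:E).
  exact: measurable_powR_expRN.
have [] := (ae_eq_integral_abs (@lebesgue_measure R) (measurable_itv `]0, +oo[) mf).1.
  rewrite -[RHS]g0; apply: eq_integral => x _.
  by rewrite gee0_abs// lee_fin mulr_ge0 ?powR_ge0 ?expR_ge0.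
move=> N [mN N0 DN].
have : (@lebesgue_measure R `]0%R, +oo[ <= lebesgue_measure N)%E.
  apply: le_measure; rewrite ?inE//.
  move=> x /= x0; apply: DN => /= /(_ x0) /eqP; apply/negP.
  move: x0; rewrite in_itv/= andbT => x0.
  by rewrite eqe mulf_eq0 negb_or gt_eqF ?powR_gt0// gt_eqF ?expR_gt0.
by rewrite N0 lebesgue_measure_itv/= ltry.
Qed.

Lemma Gamma_ge0 {R : realType} (a : R) : 0 <= Gamma a.
Proof. exact/fine_ge0/gamma_integral_ge0. Qed.

Lemma GammaE {R : realType} (a : R) : 0 < a -> (Gamma a)%:E = gamma_integral a.
Proof.
move=> a0; rewrite /Gamma /Rintegral fineK//.
by rewrite ge0_fin_numE ?gamma_integral_lty ?gamma_integral_ge0.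
Qed.

Lemma Gamma_gt0 {R : realType} (a : R) : 0 < a -> 0 < Gamma a.
Proof. by move=> a0; rewrite -lte_fin GammaE// gamma_integral_gt0. Qed.

Lemma GammaS {R : realType} (a : R) : 0 < a -> Gamma (a + 1) = a * Gamma a.
Proof.
by move=> a0; apply: EFin_inj; rewrite EFinM !GammaE ?addr_gt0// gamma_integralS.
Qed.

(** Substituting [b * t] for the variable in [Gamma a] produces the factor
    [b * b ^ (a - 1) = b ^ a]. *)
Lemma integral_powR_expR {R : realType} (a b : R) : 0 < a -> 0 < b ->
  (\int[@lebesgue_measure R]_(t in `]0%R, +oo[)
     (t `^ (a - 1) * expR (- (b * t)))%:E)%E = (Gamma a / b `^ a)%:E.
Proof.
move=> a0 b0; have ba0 : 0 < b `^ a by exact: powR_gt0.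
have := GammaE _ a0; rewrite /gamma_integral.
rewrite (ge0_integral_scale b)//; last 2 first.
- exact: measurable_powR_expRN.
- by move=> x _; rewrite lee_fin mulr_ge0 ?powR_ge0 ?expR_ge0.
under eq_integral => x.
  rewrite inE/= in_itv/= andbT => x0.
  rewrite powRM ?(ltW b0) ?(ltW x0)// -mulrA EFinM; over.
rewrite /= ge0_integralZl_EFin ?powR_ge0//; last 2 first.
- by move=> x _; rewrite lee_fin mulr_ge0 ?powR_ge0 ?expR_ge0.
- apply/measurable_EFinP; apply: measurable_powR_expR.
  by apply: measurableT_comp => //; exact: mulrl_measurable.
rewrite muleA -EFinM mulr_powRB1 ?(ltW b0)// => GE.
by rewrite mulrC EFinM GE muleA -EFinM mulVf ?gt_eqF// mul1e.
Qed.

(** * Exponential and negative binomial series in the extended reals *)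

Lemma expR_eseries {R : realType} (x : R) :
  (\sum_(0 <= r <oo) (x ^+ r / r`!%:R)%:E)%E = (expR x)%:E.
Proof.
rewrite expRE -EFin_lim; last first.
  rewrite /pseries/=; under eq_fun do rewrite mulrC.
  exact: is_cvg_series_exp_coeff.
apply/congr_lim/funext => n/=; rewrite /pseries/= /series/= -sumEFin//.
by under eq_bigr do rewrite mulrC.
Qed.

(* Summing under the integral sign in
   [Gamma (c + r) * z ^+ r = \int t `^ (c - 1) * expR (- t) * (z * t) ^+ r]
   turns the binomial series into the exponential one. *)
Lemma Gamma_binomial_series {R : realType} (c z : R) : 0 < c -> 0 <= z < 1 ->
  (\sum_(0 <= r <oo) (Gamma (c + r%:R) / r`!%:R * z ^+ r)%:E)%E =
  (Gamma c / (1 - z) `^ c)%:E.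
Proof.
move=> c0 /andP[z0 z1].
rewrite -integral_powR_expR ?subr_gt0//.
pose h r (t : R) := t `^ (c - 1) * expR (- t) * ((z * t) ^+ r / r`!%:R).
transitivity (\sum_(0 <= r <oo)
    \int[@lebesgue_measure R]_(t in `]0%R, +oo[) (h r t)%:E)%E.
  apply: eq_eseriesr => r _.
  have cr0 : 0 < c + r%:R by rewrite ltr_wpDr.
  rewrite [X in X%:E](_ : _ = z ^+ r / r`!%:R * Gamma (c + r%:R)); last by ring.
  rewrite EFinM GammaE// /gamma_integral -ge0_integralZl_EFin//; last 3 first.
  - by move=> x _; rewrite lee_fin mulr_ge0 ?powR_ge0 ?expR_ge0.
  - exact: measurable_powR_expRN.
  - by rewrite divr_ge0 ?exprn_ge0.
  apply: eq_integral => t; rewrite inE/= in_itv/= andbT => t0.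
  rewrite -EFinM /h; congr EFin.
  rewrite addrAC (@powRD _ t (c - 1) r%:R) ?(gt_eqF t0) ?implybT//.
  rewrite powR_mulrn ?(ltW t0)// exprMn.
  by ring.
rewrite -integral_nneseries//; last 2 first.
- move=> r; apply/measurable_EFinP; apply: measurable_funM.
    by apply: measurable_powR_expR; exact: oppr_measurable.
  apply: measurable_funM => //; apply: measurable_funX.
  exact: mulrl_measurable.
- move=> r t; rewrite /= in_itv/= andbT => t0.
  rewrite lee_fin /h !mulr_ge0 ?powR_ge0 ?expR_ge0 ?exprn_ge0//.
  by rewrite mulr_ge0// ltW.
apply: eq_integral => t; rewrite inE/= in_itv/= andbT => t0.
under eq_eseriesr do rewrite /h EFinM.
rewrite nneseriesZl; last first.
  by move=> r _; rewrite lee_fin divr_ge0 ?exprn_ge0 ?mulr_ge0 ?(ltW t0).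
rewrite expR_eseries -EFinM -mulrA -expRD; congr (_ * expR _)%:E.
by ring.
Qed.

(** In the part weighted by [r / a] the term [r = 0] vanishes, and [r / r! = 1 / (r-1)!]. Shifting
    the index therefore gives [z / a] times the binomial series at [c + 1], and
    [Gamma (c + 1) = c * Gamma c]. *)
Lemma Gamma_binomial_series_linear {R : realType} (a c z : R) :
  0 < a -> 0 < c -> 0 <= z < 1 ->
  (\sum_(0 <= r <oo) (Gamma (c + r%:R) / r`!%:R * z ^+ r * (1 + r%:R / a))%:E)%E =
  (Gamma c / (1 - z) `^ c * (1 + c / a * (z / (1 - z))))%:E.
Proof.
move=> a0 c0 /[dup] z01 /andP[z0 z1].
have G0 r d : 0 <= Gamma (d + r%:R) / r`!%:R * z ^+ r.
  by rewrite mulr_ge0 ?exprn_ge0// divr_ge0 ?Gamma_ge0.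
under eq_eseriesr do rewrite mulrDr mulr1 EFinD.
rewrite nneseriesD; last 2 first.
- by move=> r _ _; rewrite lee_fin G0.
- by move=> r _ _; rewrite lee_fin mulr_ge0 ?G0 ?divr_ge0 ?(ltW a0).
rewrite Gamma_binomial_series//.
rewrite [X in (_ + X)%E]nneseries_recl//; last first.
  by move=> r _; rewrite lee_fin mulr_ge0 ?G0 ?divr_ge0 ?(ltW a0).
rewrite mul0r mulr0 add0e -(nneseries_addn 1); last first.
  by move=> r; rewrite lee_fin mulr_ge0 ?G0 ?divr_ge0 ?(ltW a0).
transitivity ((Gamma c / (1 - z) `^ c)%:E +
  \sum_(0 <= r <oo) ((z / a)%:E * (Gamma (c + 1 + r%:R) / r`!%:R * z ^+ r)%:E))%E.
  congr (_ + _)%E; apply: eq_eseriesr => r _.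
  rewrite -EFinM; congr EFin.
  rewrite addn1 factS natrM exprS -(natr1 r) [r%:R + 1]addrC addrA.
  by field; rewrite ?gt_eqF//=.
rewrite nneseriesZl; last by move=> r _; rewrite lee_fin G0.
rewrite Gamma_binomial_series ?addr_gt0// GammaS// -EFinM -EFinD; congr EFin.
have z1' : 0 < 1 - z by rewrite subr_gt0.
have zc0 : (1 - z) `^ c != 0 by rewrite gt_eqF// powR_gt0.
rewrite powRD ?(gt_eqF z1') ?implybT// powRr1 ?(ltW z1')//.
by field; rewrite zc0 (gt_eqF z1') gt_eqF.
Qed.

(** * Noncentral and central F densities *)

(** Separates a factor free of [r] and [lambda], and collects all [r]-th powers into one base linear
    in [lambda], ready for integration against the prior. *)
Lemma ncF_termE {R : realType} (k m lambda f : R) (r : nat) :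
  0 < k -> 0 < m -> 0 < f ->
  ncF_term k m lambda f r =
  f `^ (k / 2 - 1) / (1 + k * f / m) `^ ((k + m) / 2)
  * ((lambda * (k * f / (2 * (m + k * f)))) ^+ r / r`!%:R
     * (Gamma ((k + m) / 2 + r%:R) / (Gamma (k / 2 + r%:R) * Gamma (m / 2)))).
Proof.
move=> k0 m0 f0; rewrite /ncF_term /Beta.
have s0 : 0 < 1 + k * f / m by rewrite addr_gt0 ?divr_gt0 ?mulr_gt0.
have mkf0 : 0 < m + k * f by rewrite addr_gt0 ?mulr_gt0.
rewrite -[r%:R + k / 2 - 1]addrA !powRD ?(gt_eqF s0) ?(gt_eqF f0) ?implybT//.
rewrite !powR_mulrn ?(ltW s0) ?(ltW f0)//.
have -> : k / 2 + r%:R + m / 2 = (k + m) / 2 + r%:R by field.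
have -> : lambda * (k * f / (2 * (m + k * f))) =
    k * lambda / (2 * m) * (f * (1 + k * f / m)^-1).
  by field; rewrite !gt_eqF//= mulr_gt0 // mulr_gt0.
move: (k * lambda / (2 * m)) => X; rewrite exprMn expr_div_n.
have G0 (d : R) : 0 < d -> Gamma d != 0 by move=> d0; rewrite gt_eqF// Gamma_gt0.
have ka0 : 0 < k / 2 by rewrite divr_gt0.
have ma0 : 0 < m / 2 by rewrite divr_gt0.
have ca0 : 0 < (k + m) / 2 by rewrite divr_gt0// addr_gt0.
have /G0 := ltr_wpDr (ler0n R r) ka0; have /G0 := ltr_wpDr (ler0n R r) ca0.
have := G0 _ ma0.
have : (1 + k * f / m) ^+ r != 0 by rewrite gt_eqF// exprn_gt0.
have : (1 + k * f / m) `^ ((k + m) / 2) != 0 by rewrite gt_eqF// powR_gt0.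
have : (r`!%:R : R) != 0 by rewrite gt_eqF// ltr0n fact_gt0.
(* With powers and Gamma values abstracted to nonzero atoms, a rational identity remains. *)
move: (_ ^+ r) (_ ^+ r) (_ ^+ r) (_ `^ _) (_ `^ _) (Gamma _) (Gamma _) (Gamma _) (_%:R).
move=> *.
by field; repeat (apply/andP; split).
Qed.

Lemma ncF_term_ge0 {R : realType} (k m lambda f : R) (r : nat) :
  0 < k -> 0 < m -> 0 <= lambda -> 0 <= ncF_term k m lambda f r.
Proof.
move=> k0 m0 l0; rewrite /ncF_term /Beta.
apply: mulr_ge0; last by rewrite divr_ge0 ?powR_ge0.
apply: divr_ge0; last by rewrite divr_ge0 ?mulr_ge0 ?Gamma_ge0.
by rewrite divr_ge0// exprn_ge0// divr_ge0 ?mulr_ge0// ltW.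
Qed.

Lemma ncF_pdf0 {R : realType} (k m f : R) : 0 < k -> 0 < m -> 0 < f ->
  ncF_pdf k m 0 f =
  ((k / m) `^ (k / 2) * (f `^ (k / 2 - 1) / (1 + k * f / m) `^ ((k + m) / 2)
   * (Gamma ((k + m) / 2) / (Gamma (k / 2) * Gamma (m / 2)))))%:E.
Proof.
move=> k0 m0 f0; rewrite /ncF_pdf f0 oppr0 mul0r expR0 mulr1.
rewrite nneseries_recl//; last by move=> r _; rewrite lee_fin ncF_term_ge0.
rewrite eseries0; last first.
  (* At [lambda = 0] every term of positive index contains [0 ^ (r+1)]; only the initial term, with
     [0 ^ 0 = 1], survives. *)
  by move=> [//|r] _ _; rewrite ncF_termE// mul0r expr0n/= mul0r mul0r mulr0.
by rewrite ncF_termE// mul0r adde0 -EFinM expr0 fact0 !addr0 divr1 mul1r.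
Qed.

(** * Marginal density under the gamma prior *)

Lemma marginal_ncF_gamma {R : realType} (k m t f : R) :
  0 < k -> 0 < m -> 0 < t -> 0 < f ->
  let z := k * f * t / ((m + k * f) * (1 + t)) in
  marginal `[0, +oo[ (fun f lambda => ncF_pdf k m lambda f)
    (gamma_pdf (k / 2 + 1) (1 / (2 * t))) f =
  ((k / m) `^ (k / 2) * (f `^ (k / 2 - 1) / (1 + k * f / m) `^ ((k + m) / 2)
   * (Gamma ((k + m) / 2) / (Gamma (k / 2) * Gamma (m / 2))))
   * ((1 + t) `^ (- (k / 2) - 1) / (1 - z) `^ ((k + m) / 2)
      * (1 + (k + m) / k * (z / (1 - z)))))%:E.
Proof.
move=> k0 m0 t0 f0 z.
set a := k / 2; set c := (k + m) / 2.
have a0 : 0 < a by rewrite divr_gt0.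
have c0 : 0 < c by rewrite divr_gt0// addr_gt0.
have mkf0 : 0 < m + k * f by rewrite addr_gt0 ?mulr_gt0.
have t10 : 0 < 1 + t by rewrite addr_gt0.
(* [b = 1/2 + 1/(2t)] is the combined rate of [exp (- lambda / 2)] and the prior; [q] is the
   coefficient of [lambda] in [ncF_termE]. Then [z = q / b]. *)
pose b := (1 + t) / (2 * t); pose q := k * f / (2 * (m + k * f)).
have b0 : 0 < b by rewrite divr_gt0// mulr_gt0.
have q0 : 0 < q by rewrite divr_gt0 ?mulr_gt0.
have z01 : 0 <= z < 1.
  apply/andP; split; first by rewrite divr_ge0 ?mulr_ge0 ?ltW.
  rewrite ltr_pdivrMr ?mulr_gt0// mul1r.
  by have := mulr_gt0 m0 t10; have := mulr_gt0 k0 f0; nra.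
pose D := (k / m) `^ a * (f `^ (a - 1) / (1 + k * f / m) `^ c)
   / Gamma (m / 2) * ((1 / (2 * t)) `^ (a + 1) / Gamma (a + 1)).
pose C r := D * (q ^+ r / r`!%:R * (Gamma (c + r%:R) / Gamma (a + r%:R))).
have D0 : 0 <= D.
  apply: mulr_ge0; last by rewrite divr_ge0 ?powR_ge0 ?Gamma_ge0.
  by rewrite divr_ge0 ?Gamma_ge0// mulr_ge0 ?divr_ge0 ?powR_ge0.
have C0 r : 0 <= C r.
  apply: mulr_ge0 => //; apply: mulr_ge0; apply: divr_ge0 => //;
    by [rewrite exprn_ge0// ltW|exact: Gamma_ge0].
have ar0 r : 0 < a + 1 + r%:R by rewrite ltr_wpDr// addr_gt0.
(* Prior and likelihood merge, term by term, into a gamma kernel of shape [a + 1 + r] and rate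
   [b]. *)
transitivity (\int[@lebesgue_measure R]_(l in `[0%R, +oo[)
    \sum_(0 <= r <oo) ((C r)%:E * (l `^ (a + 1 + r%:R - 1) * expR (- (b * l)))%:E))%E.
  apply: eq_integral => l; rewrite inE/= in_itv/= andbT le_eqVlt => /predU1P[<-|l0].
    (* At the endpoint 0 the prior density is 0 by definition, and the kernel is 0 because its
       exponent [a + r] is positive. *)
    rewrite /gamma_pdf ltxx mule0 eseries0// => r _ _.
    rewrite powR0 ?mul0r ?mule0//.
    by rewrite addrAC addrK gt_eqF// ltr_wpDr.
  rewrite /ncF_pdf f0 /gamma_pdf l0 muleAC -EFinM.
  rewrite -nneseriesZl; last by move=> r _; rewrite lee_fin ncF_term_ge0// ltW.
  apply: eq_eseriesr => r _; rewrite -!EFinM; congr EFin; rewrite ncF_termE//.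
  rewrite [a + 1 + r%:R - 1]addrAC (@powRD _ l (a + 1 - 1) r%:R) ?(gt_eqF l0) ?implybT//.
  rewrite powR_mulrn ?(ltW l0)// exprMn.
  have -> : expR (- (b * l)) = expR (- l / 2) * expR (- (1 / (2 * t) * l)).
    by rewrite -expRD; congr expR; rewrite /b; field; rewrite gt_eqF.
  rewrite /C /D -/a -/c -/q (invfM (Gamma (a + r%:R))).
  by move: (q ^+ r) => *; ring.
have mI r : measurable_fun (`[0, +oo[ : set R)
    (fun l => (l `^ (a + 1 + r%:R - 1) * expR (- (b * l)))%:E).
  apply/measurable_EFinP; apply: measurable_powR_expR.
  by apply: measurableT_comp => //; exact: mulrl_measurable.
rewrite integral_nneseries//; last 2 first.
- by move=> r; apply: measurable_funeM; exact: mI.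
- by move=> r l _; rewrite mule_ge0// lee_fin// mulr_ge0 ?powR_ge0 ?expR_ge0.
transitivity (\sum_(0 <= r <oo) ((D * a / b `^ (a + 1))%:E *
   (Gamma (c + r%:R) / r`!%:R * z ^+ r * (1 + r%:R / a))%:E))%E.
  apply: eq_eseriesr => r _.
  rewrite ge0_integralZl_EFin//; last 2 first.
  - by move=> l _; rewrite lee_fin mulr_ge0 ?powR_ge0 ?expR_ge0.
  - exact: mI.
  (* Removing the null point 0 gives the open half-line of the gamma integral. *)
  rewrite -integral_itv_obnd_cbnd; last first.
    by apply: measurable_funS (mI r) => //; apply: subset_itvr; rewrite bnd_simp.
  rewrite integral_powR_expR// -!EFinM; congr EFin.
  rewrite [a + 1 + _]addrAC GammaS ?ltr_wpDr//.
  rewrite -addrAC (@powRD _ b (a + 1) r%:R) ?(gt_eqF b0) ?implybT//.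
  rewrite powR_mulrn ?(ltW b0)//.
  have -> : z = q / b by rewrite /z /q /b; field; rewrite !gt_eqF.
  rewrite /C [(q / b) ^+ r]expr_div_n.
  have : (r`!%:R : R) != 0 by rewrite gt_eqF// ltr0n fact_gt0.
  have : b ^+ r != 0 by rewrite gt_eqF// exprn_gt0.
  have : b `^ (a + 1) != 0 by rewrite gt_eqF// powR_gt0.
  have : Gamma (a + r%:R) != 0 by rewrite gt_eqF// Gamma_gt0// ltr_wpDr.
  have : a != 0 by rewrite gt_eqF.
  move: (q ^+ r) (b ^+ r) (b `^ _) (Gamma (a + _)) (Gamma (c + _)) (r`!%:R : R) => *.
  by field; repeat (apply/andP; split).
rewrite nneseriesZl; last first.
  move=> r _; rewrite lee_fin; apply: mulr_ge0.
    case/andP: z01 => z0 _.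
    by apply: mulr_ge0; [rewrite divr_ge0 ?Gamma_ge0|exact: exprn_ge0].
  by rewrite addr_ge0// divr_ge0// ltW.
rewrite Gamma_binomial_series_linear// -EFinM; congr EFin.
(* The prior's normalising power over that of the combined kernel: the ratio of the two rates is
   [1 / (1 + t)]. *)
have -> : (1 + t) `^ (- a - 1) = (1 / (2 * t)) `^ (a + 1) / b `^ (a + 1).
  have t20 : 0 < (2 * t)^-1 by rewrite invr_gt0 mulr_gt0.
  rewrite -opprD powRN mul1r /b powRM ?(ltW t10) ?(ltW t20)//.
  by field; rewrite !gt_eqF// powR_gt0.
have -> : c / a = (k + m) / k by rewrite /a /c; field; rewrite gt_eqF.
rewrite /D GammaS//.
have : a != 0 by rewrite gt_eqF.
have : Gamma a != 0 by rewrite gt_eqF// Gamma_gt0.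
have : Gamma (m / 2) != 0 by rewrite gt_eqF// Gamma_gt0// divr_gt0.
have : b `^ (a + 1) != 0 by rewrite gt_eqF// powR_gt0.
have : (1 - z) `^ c != 0 by rewrite gt_eqF// powR_gt0// subr_gt0; case/andP: z01.
have : (1 + k * f / m) `^ c != 0.
  by rewrite gt_eqF// powR_gt0// addr_gt0 ?divr_gt0 ?mulr_gt0.
move: (1 + (k + m) / k * _) => X.
move: (Gamma a) (Gamma c) (Gamma _) ((1 - z) `^ _) (b `^ _) ((1 / _) `^ _).
move: ((1 + _) `^ c) ((k / m) `^ _) (f `^ _) => *.
by field; repeat (apply/andP; split).
Qed.

(** * Closed form of the quotient of the marginal and central densities *)

Theorem theorem4 (R : realType) (tau k m : R)
    (tau_gt0 : 0 < tau) (k_gt0 : 0 < k) (m_gt0 : 0 < m) (f : R) (f_gt0 : 0 < f) :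
  let v := m * (tau ^+ 2 + 1) in
  BF10 k m (tau ^+ 2) f =
  ((tau ^+ 2 + 1) `^ (- (k / 2) - 1)
   * ((1 + k * f / m) / (1 + k * f / v)) `^ ((k + m) / 2)
   * (1 + (k + m) * tau ^+ 2 * f / (v * (1 + k * f / v))))%:E.
Proof.
move=> v; have t0 : 0 < tau ^+ 2 by rewrite exprn_gt0.
rewrite /BF10 /bayes_factor marginal_ncF_gamma// ncF_pdf0//.
move: (tau ^+ 2) t0 => t t0 in v *.
(* [M] is the central density at [f], a factor of the marginal too; its positivity makes the
   extended-real quotient an ordinary one in which it cancels. *)
set M := (k / m) `^ (k / 2) * _.
have M0 : 0 < M.
  have c0 : 0 < 1 + k * f / m by rewrite addr_gt0 ?divr_gt0 ?mulr_gt0.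
  have Ga : 0 < Gamma (k / 2) by rewrite Gamma_gt0// divr_gt0.
  have Gm : 0 < Gamma (m / 2) by rewrite Gamma_gt0// divr_gt0.
  have Gc : 0 < Gamma ((k + m) / 2) by rewrite Gamma_gt0// divr_gt0// addr_gt0.
  apply: mulr_gt0; first by rewrite powR_gt0// divr_gt0.
  by apply: mulr_gt0; apply: divr_gt0; rewrite ?powR_gt0 ?mulr_gt0.
rewrite inver gt_eqF// -EFinM mulrAC mulfV ?gt_eqF// mul1r; congr EFin.
have t10 : 0 < 1 + t by rewrite addr_gt0.
have mkf0 : 0 < m + k * f by rewrite addr_gt0 ?mulr_gt0.
have w0 : 0 < m * (1 + t) + k * f by rewrite addr_gt0 ?mulr_gt0.
set z := k * f * t / _.
have z0 : 1 - z = (m * (1 + t) + k * f) / ((m + k * f) * (1 + t)).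
  by rewrite /z; field; rewrite !gt_eqF.
have z1 : 0 < 1 - z by rewrite z0 divr_gt0 ?mulr_gt0.
(* The ratio in brackets is exactly [1 / (1 - z)]. *)
have -> : ((1 + k * f / m) / (1 + k * f / v)) `^ ((k + m) / 2) =
    ((1 - z) `^ ((k + m) / 2))^-1.
  rewrite -powRN -[- ((k + m) / 2)]mulN1r (powRrM (1 - z) (-1)).
  rewrite powR_inv1 ?(ltW z1)// z0 /v.
  by congr powR; field; rewrite !gt_eqF// [t + 1]addrC mulr_gt0.
rewrite [t + 1]addrC; congr (_ * (1 + _)).
(* Here [z / (1 - z) = k * f * t / (v + k * f)], and its factor [k] cancels the denominator of
   [(k + m) / k]. *)
by rewrite z0 /z /v; field; rewrite [t + 1]addrC !gt_eqF.
Qed.
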